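(* Let $k\leq n-2$ and $m\geq1$, or let $k=n-1$ and $m\geq2$. If $G$ is an $m$-saturated crowded $(n-k)$-parade on $n$ vertices, then $G$ is minor maximal amongst graphs with $n$ vertices, at most $m$ parallel edges between any given pair of vertices, and spectator floor $k$.
   Context: All graphs are finite, have at least one vertex, have no loops, and may have multiple (parallel) edges. A minor of $H$ is any graph obtained from $H$ by a sequence of: deleting an isolated vertex, deleting an edge, contracting an edge that has no edge parallel to it. A graph $G$ in a class $\mathcal{C}$ is minor maximal in $\mathcal{C}$ if $G\in\mathcal{C}$ and no graph in $\mathcal{C}$ other than $G$ has $G$ as a minor. A unique shortest path is a shortest $u$–$v$ path $P$ such that every $u$–$v$ path with the same number of vertices is identical to $P$, where two paths with different edge sequences are different even if their vertex sequences agree; a single vertex is a unique shortest path. The parade number $\mathrm{usp}(G)$ is the largest number of vertices of a unique shortest path in $G$; a parade is a unique shortest path with $\mathrm{usp}(G)$ vertices. The spectator number is $\mathrm{sp}(G)=|V(G)|-\mathrm{usp}(G)$. The spectator floor $\lfloor \mathrm{sp}\rfloor(G)$ is the minimum of $\mathrm{sp}(H)$ over all graphs $H$ of which $G$ is a minor. For $p\geq2$, a crowded $p$-parade is a graph $G$ with a parade $P$ of $p$ vertices such that (i) every vertex outside $P$ is adjacent to exactly two vertices of $P$, and those two vertices are adjacent to each other; (ii) any two vertices outside $P$ that are adjacent to a common vertex of $P$ are adjacent to each other. An $m$-saturated crowded $p$-parade ($p\geq 2$) is a crowded $p$-parade in which every edge not in the parade has exactly $m$ parallel copies (including itself). An $m$-saturated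 crowded $1$-parade is a graph in which every pair of vertices is joined by exactly $m$ edges. *)

(* Defs.v *)
From mathcomp Require Import all_boot.
From Stdlib Require Import Relations.
Set Implicit Arguments. Unset Strict Implicit. Unset Printing Implicit Defensive.

(* A finite loopless multigraph with at least one vertex, on vertex set
   'I_nv; mul x y is the number of (parallel, pairwise distinct) edges
   between x and y.  The edges between x and y are named 0, ..., mul x y - 1. *)
Record mgraph := MGraph {
  nv : nat;
  mul : 'I_nv -> 'I_nv -> nat;
  nv_pos : 0 < nv;
  mul_sym : forall x y, mul x y = mul y x;
  mul_irr : forall x, mul x x = 0 }.

Definition V (G : mgraph) := 'I_(nv G).

Definition adj (G : mgraph) (x y : V G) : bool := 0 < mul x y.

Definition iso (G H : mgraph) : Prop :=
  exists f : V G -> V H, bijective f /\ forall x y, mul (f x) (f y) = mul x y.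

Definition del_isolated (H H' : mgraph) : Prop :=
  exists v : V H, (forall x, mul v x = 0) /\
  exists f : V H' -> V H, [/\ injective f, (forall x, f x != v),
    (nv H').+1 = nv H & forall x y, mul (f x) (f y) = mul x y].

Definition del_edge (H H' : mgraph) : Prop :=
  exists a b : V H, [/\ a != b, 0 < mul a b &
  exists f : V H' -> V H, bijective f /\ forall x y,
    mul x y = mul (f x) (f y) - (((f x == a) && (f y == b)) || ((f x == b) && (f y == a)))].

Definition contract_edge (H H' : mgraph) : Prop :=
  exists a b : V H, [/\ a != b, mul a b = 1 &
  exists g : V H -> V H', [/\ g a = g b,
    (forall c d, g c = g d -> c = d \/ ((c \in [:: a; b]) && (d \in [:: a; b]))),
    (forall z, exists c, g c = z) &
    forall z w, z != w ->
      mul z w = \sum_(c : V H | g c == z) \sum_(d : V H | g d == w) mul c d]].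

Definition minor_step (H H' : mgraph) : Prop :=
  iso H H' \/ del_isolated H H' \/ del_edge H H' \/ contract_edge H H'.

Definition minor (G H : mgraph) : Prop := clos_refl_trans mgraph minor_step H G.

(* Paths: a vertex sequence vs (no repetition) together with an edge sequence
   es, where es_i names one of the mul vs_i vs_(i+1) parallel edges. *)
Definition steps (G : mgraph) (vs : seq (V G)) (es : seq nat) :=
  zip (zip vs (behead vs)) es.

Definition is_path (G : mgraph) (u v : V G) (vs : seq (V G)) (es : seq nat) : Prop :=
  [/\ ohead vs = Some u, last u vs = v, uniq vs, size es = (size vs).-1 &
      all (fun t : (V G * V G) * nat => t.2 < mul t.1.1 t.1.2) (steps vs es)].

Definition usp_path (G : mgraph) (u v : V G) (vs : seq (V G)) (es : seq nat) : Prop :=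
  is_path u v vs es /\
  forall vs' es', is_path u v vs' es' ->
    size vs <= size vs' /\ (size vs' = size vs -> vs' = vs /\ es' = es).

Definition is_usp (G : mgraph) (p : nat) : Prop :=
  (exists u v vs es, @usp_path G u v vs es /\ size vs = p) /\
  (forall u v vs es, @usp_path G u v vs es -> size vs <= p).

Definition is_sp (G : mgraph) (s : nat) : Prop :=
  exists p, is_usp G p /\ s = nv G - p.

Definition is_spfloor (G : mgraph) (k : nat) : Prop :=
  (exists H, minor G H /\ is_sp H k) /\
  (forall H s, minor G H -> is_sp H s -> k <= s).

Definition parade (G : mgraph) (u v : V G) (vs : seq (V G)) (es : seq nat) : Prop :=
  usp_path u v vs es /\ is_usp G (size vs).

Definition edge_in_path (G : mgraph) (vs : seq (V G)) (es : seq nat) (x y : V G) (j : nat) :=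
  (((x, y), j) \in steps vs es) || (((y, x), j) \in steps vs es).

Definition crowded_with (G : mgraph) (p : nat) (u v : V G) (vs : seq (V G)) (es : seq nat) :=
  [/\ parade u v vs es, size vs = p,
    (forall x, x \notin vs -> exists a b, [/\ a \in vs, b \in vs, a != b,
        [/\ adj x a, adj x b & adj a b] &
        forall c, c \in vs -> adj x c -> c = a \/ c = b]) &
    (forall x y, x \notin vs -> y \notin vs -> x != y ->
        (exists c, [/\ c \in vs, adj x c & adj y c]) -> adj x y)].

Definition sat_crowded (m p : nat) (G : mgraph) : Prop :=
  match p with
  | 0 => False
  | 1 => forall x y : V G, x != y -> mul x y = m
  | _ => exists u v vs es, crowded_with p u v vs es /\
           forall (x y : V G) (j : nat), j < mul x y -> ~~ edge_in_path vs es x y j ->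
             mul x y = m
  end.

Definition in_class (n m k : nat) (G : mgraph) : Prop :=
  [/\ nv G = n, (forall x y : V G, mul x y <= m) & is_spfloor G k].

Definition minor_maximal (n m k : nat) (G : mgraph) : Prop :=
  in_class n m k G /\ forall H, in_class n m k H -> minor G H -> iso G H.

(* Main.v *)
From Stdlib Require Import Relations.
From mathcomp Require Import all_boot zify.
Require Import Defs.
Set Implicit Arguments. Unset Strict Implicit. Unset Printing Implicit Defensive.

(** Let P be a unique shortest path of a graph H having G as a minor, let s be the number of
    vertices of H off P, and let M be the segment of P between its first and last vertices that
    lie in branch sets.  Take a walk of G joining the labels of the ends of M, with vertex set Y,
    and let U be the union of the branch sets over Y.  Some path inside U joins the ends of M, so
    |M| <= |U|; adding to U one vertex from each other branch set gives
    |G| - |Y| + |U| <= |M| + s.  Hence |G| <= s + |Y|, and equality forces U = M, which determines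
    Y and, because M is chordless and has simple edges, excludes parallel edges inside Y.
    Any two vertices of a crowded p-parade are joined by a walk on at most p vertices, so its
    spectator floor is at least |G| - p.  An extra edge provides, for every pair of vertices, a
    walk on fewer than p vertices, two walks on p vertices with different vertex sets, or a walk
    on p vertices containing parallel edges; then equality is impossible and the floor grows. *)

(** * Unique geodesics of a relation *)

Section Geodesics.
Variables (T : finType) (e : rel T).

(** The list [p] omits the starting vertex [x], so [size p] counts edges. Competitors are arbitrary
    walks, which can be spliced freely. *)
Definition unique_geodesic (x : T) (p : seq T) : Prop :=
  path e x p /\ forall q, path e x q -> last x q = last x p ->
    size p <= size q /\ (size q = size p -> q = p).

Lemma unique_geodesic_sub x p1 p2 p3 :
  unique_geodesic x (p1 ++ p2 ++ p3) -> unique_geodesic (last x p1) p2.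
Proof.
move=> [+ min_p]; rewrite !cat_path => /and3P[e1 e2 e3]; split=> // q eq lastq.
have := min_p (p1 ++ q ++ p3).
rewrite !cat_path e1 eq lastq e3 !last_cat lastq !size_cat => /(_ isT erefl)[le_pq uniq_p].
split=> [|szq]; first by lia.
have /eqP := uniq_p ltac:(lia).
by rewrite eqseq_cat // eqxx /= eqseq_cat // => /andP[/eqP].
Qed.

(** The last clause passes between walks and simple paths: a walk that loses no length on removing
    its cycles had none. *)
Lemma shorten_size x p : path e x p ->
  exists q, [/\ path e x q, uniq (x :: q), last x q = last x p,
                size q <= size p & size q = size p -> uniq (x :: p)].
Proof.
move=> e_p; case/shortenP: (e_p) => q e_q uniq_q sub_qp.
have uq : uniq q by case/andP: uniq_q.
exists q; split=> //; first exact: uniq_leq_size.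
move=> szq; have szle : size p <= size q by rewrite szq.
have [_ eq_qp] := uniq_min_size uq sub_qp szle.
move: uniq_q => /=; rewrite eq_qp => /andP[-> _].
exact: leq_size_uniq uq sub_qp szle.
Qed.

Lemma unique_geodesic_uniq x p : unique_geodesic x p -> uniq (x :: p).
Proof.
move=> [e_p min_p]; have [q [e_q _ lastq szq]] := shorten_size e_p; apply.
by have [szp _] := min_p q e_q lastq; apply/eqP; rewrite eqn_leq szq.
Qed.

(** The segment between positions [i] and [j] is itself a geodesic, and a chord is a competitor of
    length one. *)
Lemma unique_geodesic_chord x p i j : unique_geodesic x p ->
  i < j -> j <= size p -> e (nth x (x :: p) i) (nth x (x :: p) j) -> j = i.+1.
Proof.
move=> geo_p lt_ij le_jp eij.
have defp : p = take i p ++ take (j - i) (drop i p) ++ drop j p.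
  rewrite -{1}(cat_take_drop i p); congr (_ ++ _).
  by rewrite -{1}(cat_take_drop (j - i) (drop i p)) drop_drop subnK // ltnW.
have lasti k : k <= size p -> last x (take k p) = nth x (x :: p) k.
  case: k => [|k] lt_kp; first by rewrite take0.
  by rewrite (last_nth x) size_takel // /= nth_take.
have [_] : unique_geodesic (nth x (x :: p) i) (take (j - i) (drop i p)).
  rewrite -lasti; last by lia.
  by apply: (@unique_geodesic_sub _ _ _ (drop j p)); rewrite -defp.
move=> /(_ [:: nth x (x :: p) j]); rewrite /= eij -lasti //.
have -> : take j p = take i p ++ take (j - i) (drop i p).
  by rewrite -takeD subnKC // ltnW.
rewrite last_cat lasti; last by lia.
move=> /(_ isT erefl)[]; rewrite size_takel ?size_drop; lia.
Qed.

Lemma unique_geodesic_index x p c d :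
  unique_geodesic x p -> irreflexive e -> symmetric e ->
  c \in x :: p -> d \in x :: p -> e c d ->
  index d (x :: p) = (index c (x :: p)).+1 \/ index c (x :: p) = (index d (x :: p)).+1.
Proof.
move=> geo_p e_irr e_sym cp dp ecd.
have lt_c : index c (x :: p) <= size p by rewrite -ltnS index_mem.
have lt_d : index d (x :: p) <= size p by rewrite -ltnS index_mem.
case: (ltngtP (index c (x :: p)) (index d (x :: p))) => [lt|lt|eq_cd].
- by left; apply: (unique_geodesic_chord geo_p lt lt_d); rewrite !nth_index.
- by right; apply: (unique_geodesic_chord geo_p lt lt_c); rewrite !nth_index // e_sym.
- by move: ecd; rewrite -(nth_index x cp) eq_cd (nth_index x dp) e_irr.
Qed.

(** With [L] the predicate of lying in a branch set, this cuts the parade down to its segment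
    between the extreme such vertices. *)
Lemma path_trim (L : pred T) x p : has L (x :: p) ->
  exists p1 p2 p3, [/\ p = p1 ++ p2 ++ p3, L (last x p1), L (last (last x p1) p2) &
    forall c, c \in x :: p -> L c -> c \in last x p1 :: p2].
Proof.
have trim_right y q : L y -> exists q1 q2, [/\ q = q1 ++ q2, L (last y q1) &
    forall c, c \in y :: q -> L c -> c \in y :: q1].
  move=> Ly; elim/last_ind: q => [|q z [q1 [q2 [-> Lq1 sub]]]]; first by exists [::], [::].
  have [Lz|nLz] := boolP (L z).
    by exists (rcons (q1 ++ q2) z), [::]; rewrite cats0 last_rcons.
  exists q1, (rcons q2 z); split=> //; first by rewrite rcons_cat.
  move=> c; rewrite -rcons_cons mem_rcons inE => /orP[/eqP-> Lz|]; last exact: sub.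
  by rewrite Lz in nLz.
elim: p x => [|z p IHp] x /=.
  rewrite orbF => Lx; exists [::], [::], [::]; split=> //.
have [Lx _|nLx] := boolP (L x).
  have [q1 [q2 [-> Lq1 sub]]] := trim_right x (z :: p) Lx.
  by exists [::], q1, q2.
move=> /IHp[p1 [p2 [p3 [-> L1 L2 sub]]]]; exists (z :: p1), p2, p3; split=> // c.
rewrite inE => /orP[/eqP-> Lx|]; last exact: sub.
by rewrite Lx in nLx.
Qed.

End Geodesics.

(** * Unique shortest paths of multigraphs as geodesics with simple edges *)

Lemma adj_irr (G : mgraph) : irreflexive (@adj G).
Proof. by move=> x; rewrite /adj mul_irr. Qed.

Lemma adj_sym (G : mgraph) : symmetric (@adj G).
Proof. by move=> x y; rewrite /adj mul_sym. Qed.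

Section Parades.
Variable G : mgraph.

(** Since [p] is [u :: p] shifted by one, [nth u p i] is the successor of the vertex at position
    [i]. *)
Definition simple_walk (u : V G) (p : seq (V G)) : Prop :=
  forall i, i < size p -> mul (nth u (u :: p) i) (nth u p i) = 1.

Lemma is_path_walk (u v : V G) vs es : is_path u v vs es ->
  exists p, [/\ vs = u :: p, path (@adj G) u p, last u p = v & uniq (u :: p)].
Proof.
case: vs => [|u' p] [//= [->]] lastp uniqp szes alles; exists p; split=> //.
elim: p u {u' lastp uniqp} es szes alles => [|w p IHp] u [|i es] //= [szes] /andP[lti alles].
by rewrite (IHp w es) // andbT; exact: leq_ltn_trans lti.
Qed.

Lemma walk_is_path (u : V G) p (F : V G -> V G -> nat) :
  (forall x y, adj x y -> F x y < mul x y) -> path (@adj G) u p -> uniq (u :: p) ->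
  is_path u (last u p) (u :: p) (pairmap F u p).
Proof.
move=> ltF e_p uniq_p; split; rewrite ?size_pairmap //.
elim: p u {uniq_p} e_p => [|w p IHp] u //= /andP[euw e_p].
by rewrite ltF //=; apply: IHp.
Qed.

(** Naming every edge of the path by its lowest index [F0], or by its highest [F1], gives two paths
    on the same vertices. Uniqueness identifies them, so each multiplicity is 1. *)
Lemma usp_path_geodesic (u v : V G) vs es : usp_path u v vs es ->
  exists p, [/\ vs = u :: p, unique_geodesic (@adj G) u p & simple_walk u p].
Proof.
move=> [/is_path_walk[p [-> e_p lastp uniq_p]] min_p]; exists p.
have F0 x y : adj x y -> (fun _ _ : V G => 0) x y < mul x y by [].
have F1 x y : adj x y -> (fun x y : V G => (mul x y).-1) x y < mul x y.
  by rewrite /adj => /prednK->.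
split=> //; last first.
  have := walk_is_path F0 e_p uniq_p; rewrite lastp => /min_p[_ /(_ erefl)[_ es0]].
  have := walk_is_path F1 e_p uniq_p; rewrite lastp => /min_p[_ /(_ erefl)[_ es1]].
  move=> i lti; have := pathP u e_p i lti; rewrite /adj.
  have := congr1 (fun s => nth 0 s i) es0; rewrite -es1 !(nth_pairmap u) //; lia.
split=> // q e_q lastq.
(* [is_path] speaks of simple paths only, so a competing walk is first made simple; if it has the
   length of [p], it was simple already. *)
have [q' [e_q' uniq_q' lastq' szq' uniq_q]] := shorten_size e_q.
have := walk_is_path F0 e_q' uniq_q'.
rewrite lastq' lastq lastp => /min_p[/= szp _].
rewrite ltnS in szp; split=> [|szq]; first by exact: leq_trans szp szq'.
have eqq : size q' = size q by apply/eqP; rewrite eqn_leq szq' szq.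
have := walk_is_path F0 e_q (uniq_q eqq).
by rewrite lastq lastp => /min_p[_ /=]; rewrite szq => /(_ erefl)[[]].
Qed.

Lemma simple_walk_mul (u : V G) p c d :
  unique_geodesic (@adj G) u p -> simple_walk u p ->
  c \in u :: p -> d \in u :: p -> mul c d <= 1.
Proof.
move=> geo_p sim_p cp dp; have [ecd|] := boolP (adj c d); last by rewrite /adj; lia.
have step a b : a \in u :: p -> b \in u :: p -> index b (u :: p) = (index a (u :: p)).+1 ->
    mul a b = 1.
  move=> ap bp eq_ab; rewrite -(sim_p (index a (u :: p))); last first.
    by rewrite -ltnS -eq_ab index_mem.
  by rewrite nth_index // -[nth u p _]/(nth u (u :: p) (index a (u :: p)).+1) -eq_ab nth_index.
have [/step->|/step eq_dc] // := unique_geodesic_index geo_p (@adj_irr G) (@adj_sym G) cp dp ecd.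
by rewrite mul_sym eq_dc.
Qed.

End Parades.

(** * Minors as branch-set models *)

Lemma connect_lift (A B : finType) (e : rel A) (r : rel B) (F : A -> B -> bool) :
  (forall z a a', F a z -> F a' z -> connect e a a') ->
  (forall z w, r z w -> exists a b, [/\ F a z, F b w & connect e a b]) ->
  forall z w, connect r z w -> forall a b, F a z -> F b w -> connect e a b.
Proof.
(* Each step of the walk in [B] lifts to [A], and consecutive lifts are joined inside a fibre of
   [F]. *)
move=> fibre step z _ /connectP[p r_p ->].
elim: p z r_p => [|y p IHp] z /=; first by move=> _ a b; apply: fibre.
move=> /andP[/step[c [d [Fc Fd e_cd]]] r_p] a b Fa Fb.
exact: connect_trans (fibre _ _ _ Fa Fc) (connect_trans e_cd (IHp _ r_p _ _ Fd Fb)).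
Qed.

Section Models.
Variables (T : finType) (mu : T -> T -> nat).

(* The branch set of x is lab @^-1 (Some x); vertices labelled None are the deleted ones. *)
Definition model (H : mgraph) (lab : V H -> option T) : Prop :=
  [/\ forall x, exists c, lab c = Some x,
      forall x c d, lab c = Some x -> lab d = Some x ->
        connect [rel c d | [&& adj c d, lab c == Some x & lab d == Some x]] c d &
      forall x y, x != y ->
        mu x y <= \sum_(c | lab c == Some x) \sum_(d | lab d == Some y) mul c d].

(** Treats isomorphism, vertex deletion and edge deletion together. Vertices outside the image of
    [f] become unlabelled. *)
Lemma model_sub (H H' : mgraph) (f : V H' -> V H) (lab' : V H' -> option T) :
  injective f -> (forall z w, mul z w <= mul (f z) (f w)) ->
  model lab' -> exists lab : V H -> option T, model lab.
Proof.
move=> inj_f le_f [rep conn edges].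
pose lab c := obind lab' [pick z | f z == c].
have lab_f z : lab (f z) = lab' z.
  by rewrite /lab; case: pickP => [w /eqP/inj_f-> | /(_ z)/eqP].
have lab_some c x : lab c = Some x -> exists2 z, c = f z & lab' z = Some x.
  by rewrite /lab; case: pickP => // z /eqP <- /= ?; exists z.
have lab_sum x (F : V H -> nat) :
    \sum_(c | lab c == Some x) F c = \sum_(z | lab' z == Some x) F (f z).
  have inj_fP : {in [pred z | lab' z == Some x] &, injective f} by move=> z w _ _ /inj_f.
  rewrite -(big_imset F inj_fP); apply: eq_bigl => c.
  apply/eqP/imsetP => [/lab_some[z -> labz]|[z labz ->]]; first by exists z; rewrite ?inE ?labz.
  by rewrite lab_f; apply/eqP.
exists lab; split=> [x|x c d|x y /edges/leq_trans-> //].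
- by have [z labz] := rep x; exists (f z); rewrite lab_f.
- move=> /lab_some[z -> labz] /lab_some[w -> labw].
  have := @connect_lift _ _ [rel c d | [&& adj c d, lab c == Some x & lab d == Some x]]
    _ (fun c z => c == f z) _ _ _ _ (conn x z w labz labw).
  apply=> // [z' a a' /eqP-> /eqP-> //|z' w' /and3P[ezw labz' labw']].
  exists (f z'), (f w'); split=> //; apply: connect1; rewrite /= !lab_f labz' labw' !andbT.
  exact: leq_trans ezw (le_f _ _).
- rewrite lab_sum; apply: leq_sum => c _; rewrite lab_sum; exact: leq_sum.
Qed.

Lemma sum2_gt0P (I J : finType) (P : pred I) (Q : pred J) (F : I -> J -> nat) :
  0 < \sum_(i | P i) \sum_(j | Q j) F i j -> exists i j, [/\ P i, Q j & 0 < F i j].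
Proof.
rewrite lt0n sum_nat_eq0 negb_forall => /existsP[i].
rewrite negb_imply sum_nat_eq0 negb_forall => /andP[Pi /existsP[j]].
rewrite negb_imply -lt0n => /andP[Qj Fij]; by exists i, j.
Qed.

(** The labelling is pulled back along [g]. The contracted edge lies inside a branch set or among
    unlabelled vertices: in the first case it keeps the branch set connected, and it never runs
    between two branch sets. *)
Lemma model_contract (H H' : mgraph) (lab' : V H' -> option T) :
  contract_edge H H' -> model lab' -> exists lab : V H -> option T, model lab.
Proof.
move=> [a [b [ab mul_ab [g [gab g_inj g_onto mul_g]]]]] [rep conn edges].
exists (lab' \o g); split=> [x|x c d labc labd|x y neq_xy].
- have [z labz] := rep x; have [c gc] := g_onto z; by exists c; rewrite /= gc.
- apply: (@connect_lift _ _ [rel c d | [&& adj c d, (lab' \o g) c == Some x & (lab' \o g) d == Some x]]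
    _ (fun c z => (g c == z) && (lab' z == Some x)) _ _ _ _ (conn x _ _ labc labd)).
  + move=> z {labc labd} {}c {}d /andP[/eqP gc labz] /andP[/eqP gd _].
    have [|->|/andP[cab dab]] := g_inj c d; rewrite ?gc ?gd //.
    have lab_ab : (lab' (g a) == Some x) && (lab' (g b) == Some x).
      by move: cab; rewrite -gab andbb !inE => /orP[]/eqP eqc; [|rewrite gab]; rewrite -eqc gc.
    have /andP[laba labb] := lab_ab.
    move: cab dab; rewrite !inE => /orP[]/eqP-> /orP[]/eqP-> //; apply: connect1;
      by rewrite /= laba labb /adj 1?(mul_sym b a) mul_ab.
  + move=> z w /and3P[ezw labz labw].
    have neq_zw : z != w by apply: contraTneq ezw => ->; rewrite adj_irr.
    move: ezw; rewrite /adj mul_g // => /sum2_gt0P[c' [d' [/eqP gc /eqP gd ecd]]].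
    exists c', d'; rewrite gc gd !eqxx labz labw; split=> //.
    by apply: connect1; rewrite /= gc gd labz labw !andbT.
  + by rewrite /= eqxx; apply/eqP.
  + by rewrite /= eqxx; apply/eqP.
- apply: leq_trans (edges x y neq_xy) _.
  (* Grouping both endpoints by their images under [g] turns the count in [H] into the count in
     [H']. Images with different labels are distinct, so [mul_g] applies. *)
  rewrite [X in _ <= X](partition_big g (fun z => lab' z == Some x)) //=.
  apply: leq_sum => z labz.
  rewrite (exchange_big_dep (fun d => lab' (g d) == Some y)) //=.
  rewrite [X in _ <= X](partition_big g (fun z => lab' z == Some y)) //=.
  apply: leq_sum => w labw; rewrite mul_g; last first.
    apply: contraNneq neq_xy => eqzw; move: labw; rewrite -eqzw (eqP labz).
    by move=> /eqP[->].
  rewrite exchange_big /=; apply: eq_leq.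
  apply: eq_big => [d|d gd].
    by case: (g d =P w) => [->|]; rewrite ?andbF ?labw.
  by apply: eq_bigl => c; rewrite (eqP gd) labw; case: (g c =P z) => [->|]; rewrite ?andbF ?labz.
Qed.

Lemma model_minor (H H' : mgraph) (lab' : V H' -> option T) :
  minor H' H -> model lab' -> exists lab : V H -> option T, model lab.
Proof.
rewrite /minor => minH mod_lab'.
have : exists lab : V H' -> option T, model lab by exists lab'.
elim: minH {lab' mod_lab'} => [{}H {}H' step [lab' mod_lab'] | // | G1 G2 G3 _ IH1 _ IH2 /IH2/IH1 //].
case: step => [[f [[g gK fK] mul_f]]|[[v [_ [f [inj_f _ _ mul_f]]]]|[[a [b [_ _ [f [[g gK fK] mul_f]]]]]|contr]]].
- apply: model_sub (can_inj fK) _ mod_lab' => z w.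
  by rewrite -mul_f !fK.
- by apply: model_sub inj_f _ mod_lab' => z w; rewrite mul_f.
- by apply: model_sub (can_inj gK) _ mod_lab' => z w; rewrite mul_f leq_subr.
- exact: model_contract contr mod_lab'.
Qed.

Lemma model_bij (H : mgraph) (f : T -> V H) :
  bijective f -> (forall x y, mu x y <= mul (f x) (f y)) ->
  exists lab : V H -> option T, model lab.
Proof.
case=> g gK fK le_f; have lab_sum x (F : V H -> nat) : \sum_(c | Some (g c) == Some x) F c = F (f x).
  by apply: big_pred1 => c; apply/eqP/eqP => [[<-]|->]; rewrite ?fK ?gK.
exists (Some \o g); split=> [x|x c d [gc] [gd]|x y _ /=].
- by exists (f x); rewrite /= gK.
- by rewrite -(fK c) -(fK d) gc gd connect0.
- by rewrite !lab_sum.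
Qed.

Lemma model_repr (H : mgraph) (lab : V H -> option T) : model lab ->
  exists f : T -> V H, forall x, lab (f x) = Some x.
Proof. by case=> rep _ _; exact: (fin_all_exists (U := fun=> V H) rep). Qed.

(** With as many vertices as labels, every branch set is a singleton. *)
Lemma model_spanning (H : mgraph) (lab : V H -> option T) : model lab -> #|T| = nv H ->
  exists f : T -> V H, bijective f /\ forall x y, x != y -> mu x y <= mul (f x) (f y).
Proof.
move=> mod_lab cardT; have [f labf] := model_repr mod_lab; have [_ _ edges] := mod_lab.
have inj_f : injective f by move=> x y eqf; have := labf x; rewrite eqf labf => -[].
have bij_f : bijective f by apply: (inj_card_bij inj_f); rewrite card_ord cardT.
exists f; split=> // x y /edges; have [g gK fK] := bij_f.
have lab_sum z (F : V H -> nat) : \sum_(c | lab c == Some z) F c = F (f z).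
  by apply: big_pred1 => c; rewrite -{1}(fK c) labf; apply/eqP/eqP => [[<-]|->]; rewrite ?fK ?gK.
by rewrite !lab_sum.
Qed.

End Models.

Lemma model_self (G : mgraph) : exists lab : V G -> option (V G), model (@mul G) lab.
Proof. by apply: (@model_bij _ _ G id) => //; exists id. Qed.

(** * Counting branch sets against a unique shortest path *)

Section SpectatorBound.
Variables (T : finType) (mu : T -> T -> nat) (H : mgraph) (lab : V H -> option T).
Hypothesis mod_lab : model mu lab.
Variables (u : V H) (p : seq (V H)).
Hypotheses (geo_p : unique_geodesic (@adj H) u p) (sim_p : simple_walk u p).

Definition joined (x y : T) : bool := 0 < mu x y.

Definition branch_union (Y : {set T}) : {set V H} :=
  [set c | oapp (fun z => z \in Y) false (lab c)].

Lemma branch_union_inj Y Y' : branch_union Y = branch_union Y' -> Y = Y'.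
Proof.
move=> eqU; have [f labf] := model_repr mod_lab.
by apply/setP => z; have := congr1 (fun U : {set V H} => f z \in U) eqU; rewrite !inE !labf.
Qed.

Lemma branch_union_connect (Y : {set T}) x q c d :
  path joined x q -> {subset x :: q <= Y} -> lab c = Some x -> lab d = Some (last x q) ->
  connect [rel c d | [&& adj c d, c \in branch_union Y & d \in branch_union Y]] c d.
Proof.
move=> e_q sub_q labc labd; have [_ conn edges] := mod_lab.
have lab_in c' z : z \in Y -> lab c' == Some z -> c' \in branch_union Y.
  by move=> Yz /eqP labc'; rewrite inE labc'.
have fibre z c' d' : (lab c' == Some z) && (z \in Y) -> (lab d' == Some z) && (z \in Y) ->
    connect [rel c d | [&& adj c d, c \in branch_union Y & d \in branch_union Y]] c' d'.
  move=> /andP[/eqP labc' Yz] /andP[/eqP labd' _]; move: (conn z c' d' labc' labd').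
  apply: connect_sub => a b /and3P[eab laba labb]; apply: connect1.
  by rewrite /= eab (lab_in a z) ?(lab_in b z).
apply: (@connect_lift _ _ [rel c d | [&& adj c d, c \in branch_union Y & d \in branch_union Y]]
  [rel z w | [&& joined z w, z \in Y & w \in Y]]
  (fun c z => (lab c == Some z) && (z \in Y)) fibre _ x (last x q)).
- move=> z w /and3P[ezw Yz Yw].
  (* The clause of [model] on edges concerns distinct labels; a step from [z] to itself lifts to the
     empty path. *)
  have [eq_zw|neq_zw] := eqVneq z w.
    have [f labf] := model_repr mod_lab.
    by exists (f z), (f z); rewrite -eq_zw labf Yz eqxx connect0.
  have /sum2_gt0P[a [b [laba labb eab]]] := leq_trans ezw (edges z w neq_zw).
  exists a, b; rewrite laba labb Yz Yw; split=> //; apply: connect1.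
  by rewrite /= /adj eab (lab_in a z) ?(lab_in b w).
- apply/connectP; exists q => //; elim: q x e_q sub_q {labc labd} => //= w q IHq x /andP[exw e_q] sub_q.
  rewrite exw !sub_q ?inE ?eqxx ?orbT //=; apply: IHq => // z z_q.
  by apply: sub_q; rewrite inE z_q orbT.
- by rewrite labc eqxx sub_q ?mem_head.
- by rewrite labd eqxx sub_q ?mem_last.
Qed.

(** The set [M] is fixed before the walk [q], so any two walks attaining equality have the same
    branch union. The first alternative is the case where no vertex of the path is labelled. *)
Lemma spectator_cover :
  let s := nv H - (size p).+1 in
  #|T| <= s \/ exists x y (M : {set V H}), {subset M <= u :: p} /\
    forall q, path joined x q -> last x q = y ->
      let Y := [set z in x :: q] in
      #|T| <= s + #|Y| /\ (#|T| = s + #|Y| -> branch_union Y = M).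
Proof.
move=> s; have [f labf] := model_repr mod_lab.
have inj_f : injective f by move=> x y eqf; have := labf x; rewrite eqf labf => -[].
have uniq_p := unique_geodesic_uniq geo_p.
pose S := ~: [set c in u :: p].
have cardS : #|S| = s.
  have /card_uniqP card_p := uniq_p; have := cardsC [set c in u :: p].
  by rewrite cardsE card_p card_ord -/S => eqn; rewrite -[LHS](addKn (size p).+1) eqn.
have [/path_trim[p1 [p2 [p3 [def_p]]]]|no_lab] := boolP (has (fun c => isSome (lab c)) (u :: p)).
  case labx: (lab _) => [x|] // _; case laby: (lab _) => [y|] // _ trim.
  right; exists x, y.
  set wa := last u p1 in labx laby trim.
  have geo_p2 : unique_geodesic (@adj H) wa p2.
    by apply: (@unique_geodesic_sub _ _ _ _ _ p3); rewrite -def_p.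
  have uniq_p2 := unique_geodesic_uniq geo_p2.
  pose M := [set c in wa :: p2].
  have cardM : #|M| = (size p2).+1 by rewrite cardsE; apply/card_uniqP.
  exists M; split.
    move=> c; rewrite inE def_p -[u :: _]cat1s !mem_cat inE => /orP[/eqP->|->]; last by rewrite ?orbT.
    by rewrite orbA -mem_cat cat1s mem_last.
  move=> q e_q lastq Y.
  have sub_q : {subset x :: q <= Y} by move=> z; rewrite !inE.
  have /connectP[q1 e_q1 last_q1] : connect
      [rel c d | [&& adj c d, c \in branch_union Y & d \in branch_union Y]] wa (last wa p2).
    by apply: branch_union_connect e_q sub_q labx _; rewrite lastq.
  have [q2 [e_q2 uniq_q2 last_q2 _ _]] := shorten_size e_q1.
  have adj_q2 : path (@adj H) wa q2 by apply: sub_path e_q2 => c d /and3P[].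
  have sub_q2 : {subset wa :: q2 <= branch_union Y}.
    have : wa \in branch_union Y by rewrite inE labx /= inE mem_head.
    elim: q2 wa e_q2 {uniq_q2 last_q2 adj_q2 labx laby trim geo_p2 uniq_p2 M cardM e_q1 last_q1} => [|d q2 IHq] c /=.
      by move=> _ Uc z; rewrite inE => /eqP->.
    move=> /andP[/and3P[_ _ Ud] e_q2] Uc z; rewrite inE => /orP[/eqP-> //|].
    exact: IHq.
  have card_q2 : (size q2).+1 <= #|branch_union Y|.
    rewrite -[_.+1](card_uniqP uniq_q2).
    by apply: subset_leq_card; apply/subsetP.
  have [_ /(_ q2 adj_q2)[|le_p2 eq_p2]] := geo_p2; first by rewrite last_q2.
  (* One representative for each label outside [Y]. The labelled set made of [R] and the branch
     union lies in the union of [M] and [S], since all labelled path vertices are in [M]. *)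
  pose R := f @: ~: Y.
  have cardR : #|R| + #|Y| = #|T| by rewrite card_imset // addnC cardsC.
  have disjRU : [disjoint R & branch_union Y].
    rewrite disjoint_subset; apply/subsetP => c /imsetP[z + ->].
    by rewrite !inE labf /= !inE.
  have card_cover : #|R| + #|branch_union Y| <= #|M| + #|S|.
    rewrite -(eqTleqif (leq_card_setU _ _) disjRU).
    apply: leq_trans (leq_card_setU M S); apply: subset_leq_card; apply/subsetP => c cRU.
    have labc : isSome (lab c).
      move: cRU; rewrite inE => /orP[/imsetP[z _ ->]|]; first by rewrite labf.
      by rewrite inE; case: (lab c).
    have [cp|ncp] := boolP (c \in u :: p); first by rewrite !inE -in_cons (trim c cp labc).
    by apply/setUP; right; rewrite !inE -in_cons.
  rewrite cardS cardM in card_cover.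
  split; first by move: card_cover card_q2 le_p2 cardR; lia.
  (* Equality makes [q2] as short as the geodesic [p2], hence equal to it; then [M] lies in the
     branch union and the two have the same size. *)
  move=> tight; have szq2 : size q2 = size p2.
    by move: card_cover card_q2 le_p2 cardR tight; lia.
  apply/esym/eqP; rewrite eqEcard cardM; apply/andP; split.
    by apply/subsetP => c; rewrite inE -(eq_p2 szq2); apply: sub_q2.
  by move: card_cover cardR tight; lia.
left; rewrite -cardS -(card_imset predT inj_f); apply: subset_leq_card.
apply/subsetP => _ /imsetP[z _ ->]; rewrite !inE; apply: contra no_lab => fp.
by apply/hasP; exists (f z); rewrite ?inE ?labf.
Qed.

Definition position (c : V H) : nat := index c (u :: p).

Lemma position_inj : {in u :: p &, injective position}.
Proof. by move=> c d cp dp eq_cd; rewrite -(nth_index u cp) -(nth_index u dp) -!/(position _) eq_cd. Qed.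

Lemma adj_position c d : c \in u :: p -> d \in u :: p -> adj c d ->
  position d = (position c).+1 \/ position c = (position d).+1.
Proof. exact: unique_geodesic_index geo_p (@adj_irr H) (@adj_sym H). Qed.

(* As the path is chordless, removing d separates its two sides, so the branch set of c stays
   on the side of c. *)
Lemma branch_position x c d c' :
  lab c = Some x -> lab c' = Some x -> lab d != Some x -> d \in u :: p ->
  (forall a, lab a = Some x -> a \in u :: p) ->
  (position d = (position c).+1 -> position c' <= position c) /\
  (position c = (position d).+1 -> position c <= position c').
Proof.
move=> labc labc' labd dp sub_x; have [_ conn _] := mod_lab.
have /connectP[q] := conn x c c' labc labc'.
suff main a : lab a = Some x -> path
    [rel c d | [&& adj c d, lab c == Some x & lab d == Some x]] a q -> c' = last a q ->
  (position d = (position c).+1 -> position a <= position c -> position c' <= position c) /\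
  (position c = (position d).+1 -> position c <= position a -> position c <= position c').
  by move=> e_q lastq; have [r1 r2] := main c labc e_q lastq; split=> ?; [apply: r1|apply: r2].
elim: q a => [|b q IHq] a laba /=; first by move=> _ ->.
move=> /andP[/and3P[eab _ /eqP labb] e_q] lastq.
have [r1 r2] := IHq b labb e_q lastq.
(* Positions change by exactly one along the path in the branch set and never meet that of [d], so
   they cannot cross it. *)
have neq_bd : position b <> position d.
  by move=> /(position_inj (sub_x b labb) dp) eq_bd; rewrite -eq_bd labb eqxx in labd.
have step : position b = (position a).+1 \/ position a = (position b).+1.
  by apply: adj_position eab; apply: sub_x.
by split=> ? ?; [apply: r1 | apply: r2] => //; move: neq_bd step; lia.
Qed.

(** On a chordless path, edges join consecutive positions only. If [c] and [d] carry an edge between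
    the two sets, one set lies on the side of [c] and the other on the side of [d], so no other pair
    is adjacent. *)
Lemma branch_single_edge x y : x != y ->
  (forall c, lab c = Some x \/ lab c = Some y -> c \in u :: p) -> mu x y <= 1.
Proof.
move=> neq_xy sub_xy; have [_ _ edges] := mod_lab.
apply: leq_trans (edges x y neq_xy) _; rewrite leqNgt; apply/negP => gt1.
have /sum2_gt0P[c [d [/eqP labc /eqP labd ecd]]] := ltnW gt1.
have sub_x a : lab a = Some x -> a \in u :: p by move=> laba; apply: sub_xy; left.
have sub_y a : lab a = Some y -> a \in u :: p by move=> laba; apply: sub_xy; right.
have neq_yx : Some y != Some x by rewrite eq_sym; apply: contraNneq neq_xy => -[->].
have unique_edge c' d' : lab c' = Some x -> lab d' = Some y -> adj c' d' -> c' = c /\ d' = d.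
  move=> labc' labd' ecd'.
  have labdx : lab d != Some x by rewrite labd.
  have labcy : lab c != Some y by rewrite labc eq_sym.
  have [c1 c2] := branch_position labc labc' labdx (sub_y d labd) sub_x.
  have [d1 d2] := branch_position labd labd' labcy (sub_x c labc) sub_y.
  have idx := adj_position (sub_x c labc) (sub_y d labd) ecd.
  have idx' := adj_position (sub_x c' labc') (sub_y d' labd') ecd'.
  by split; [apply: (position_inj (sub_x c' labc') (sub_x c labc))
            |apply: (position_inj (sub_y d' labd') (sub_y d labd))];
    move: idx idx' c1 c2 d1 d2; lia.
have no_edge c' d' : lab c' = Some x -> lab d' = Some y -> c' <> c \/ d' <> d -> mul c' d' = 0.
  move=> labc' labd' neq; apply/eqP; rewrite -leqn0 leqNgt; apply/negP => ecd'.
  by have [eq_c eq_d] := unique_edge c' d' labc' labd' ecd'; case: neq.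
have rest_d : \sum_(d' | (lab d' == Some y) && (d' != d)) mul c d' = 0.
  by apply: big1 => d' /andP[/eqP labd' /eqP neq_d]; apply: no_edge => //; right.
have rest_c : \sum_(c' | (lab c' == Some x) && (c' != c)) \sum_(d' | lab d' == Some y) mul c' d' = 0.
  apply: big1 => c' /andP[/eqP labc' /eqP neq_c]; apply: big1 => d' /eqP labd'.
  by apply: no_edge => //; left.
move: gt1; rewrite (bigD1 c) ?labc //= (bigD1 d) ?labd //= rest_c rest_d !addn0.
by rewrite ltnNge (simple_walk_mul geo_p sim_p) ?(sub_x c) ?(sub_y d).
Qed.

End SpectatorBound.

(** * Lower bounds on the spectator number from walks *)

Section WalkCriteria.
Variables (T : finType) (mu : T -> T -> nat).

(** Each alternative contradicts a consequence of equality in [spectator_cover]: that the walk has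
    [p] distinct vertices, that its branch sets lie on the parade, or that its vertex set is
    determined by [M]. *)
Definition escapes (p : nat) (x y : T) : Prop :=
  exists q, [/\ path (joined mu) x q, last x q = y, size q < p &
    [\/ (size q).+1 < p,
        exists z w, [/\ z \in x :: q, w \in x :: q, z != w & 1 < mu z w] |
        exists q' z, [/\ path (joined mu) x q', last x q' = y, size q' < p,
                         z \in x :: q & z \notin x :: q']]].

Lemma card_walk (x : T) q : #|[set z in x :: q]| <= (size q).+1.
Proof. by rewrite cardsE; apply: card_size. Qed.

Variables (H : mgraph) (lab : V H -> option T) (s p : nat).
Hypotheses (mod_lab : model mu lab) (sp_H : is_sp H s).

Lemma spectators_ge :
  (forall x y, exists q, [/\ path (joined mu) x q, last x q = y & size q < p]) ->
  #|T| <= s + p.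
Proof.
move=> walks; have [_ [[[u [v [vs [es [/usp_path_geodesic[t [-> geo_t sim_t]] <-]]]]] _] ->]] := sp_H.
have [le_T|[x [y [M [_ cover]]]]] := spectator_cover mod_lab geo_t.
  by apply: leq_trans le_T (leq_addr _ _).
have [q [e_q lastq szq]] := walks x y; have [le_T _] := cover q e_q lastq.
by apply: leq_trans le_T _; rewrite leq_add2l (leq_trans (card_walk _ _)).
Qed.

Lemma spectators_gt : 0 < p -> (forall x y, escapes p x y) -> #|T| < s + p.
Proof.
move=> p_gt0 walks.
have [_ [[[u [v [vs [es [/usp_path_geodesic[t [-> geo_t sim_t]] <-]]]]] _] def_s]] := sp_H.
have [|[x [y [M [sub_M cover]]]]] := spectator_cover mod_lab geo_t.
  by rewrite /= in def_s; rewrite -def_s => le_T; lia.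
rewrite /= in def_s; rewrite -def_s in cover.
(* If the strict bound fails, every walk on at most [p] vertices has exactly [p] of them and its
   branch union is [M]. *)
have tight r : path (joined mu) x r -> last x r = y -> size r < p -> ~~ (#|T| < s + p) ->
    (size r).+1 = p /\ branch_union lab [set z in x :: r] = M.
  move=> e_r lastr szr; rewrite -leqNgt => le_T; have [le_T' eq_M] := cover r e_r lastr.
  by have := card_walk x r; split; [|apply: eq_M]; lia.
have [q [e_q lastq szq escape]] := walks x y.
apply/negPn/negP => ge_T; have [szq_p eq_M] := tight q e_q lastq szq ge_T.
case: escape => [|[z [w [zq wq neq_zw mu_zw]]]|[r [z [e_r lastr szr zq zr]]]].
- by rewrite szq_p ltnn.
- suff : mu z w <= 1 by rewrite leqNgt mu_zw.
  apply: (branch_single_edge mod_lab geo_t sim_t neq_zw) => c lab_c; apply: sub_M.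
  by rewrite -eq_M inE; case: lab_c => ->; rewrite /= inE.
- have [_] := tight r e_r lastr szr ge_T; rewrite -eq_M => /(branch_union_inj mod_lab).
  by move=> /setP/(_ z); rewrite inE (negPf zr) inE zq.
Qed.

End WalkCriteria.

(** * Interval frames of crowded parades and their canonical walks *)

Lemma walk_rev (T : finType) (e : rel T) x q : symmetric e -> path e x q ->
  exists q', [/\ path e (last x q) q', last (last x q) q' = x, size q' = size q &
                 last x q :: q' =i x :: q].
Proof.
move=> e_sym e_q; exists (rev (belast x q)); split.
- rewrite rev_path; apply: sub_path e_q => z w; by rewrite e_sym.
- by case: q {e_q} => //= w q; rewrite rev_cons last_rcons.
- by rewrite size_rev size_belast.
- by move=> z; rewrite -rev_rcons -lastI mem_rev.
Qed.

Lemma escapes_sym (T : finType) (mu : T -> T -> nat) p x y :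
  (forall z w, mu z w = mu w z) -> escapes mu p x y -> escapes mu p y x.
Proof.
move=> mu_sym; have j_sym : symmetric (joined mu) by move=> z w; rewrite /joined mu_sym.
move=> [q [e_q lastq szq escape]].
have [q1 [e_q1 lastq1 szq1 mem_q1]] := walk_rev j_sym e_q.
rewrite lastq in e_q1 lastq1 mem_q1; exists q1; rewrite szq1; split=> //.
case: escape => [?|[z [w [zq wq neq mu_zw]]]|[r [z [e_r lastr szr zq zr]]]].
- by constructor 1.
- by constructor 2; exists z, w; rewrite !mem_q1.
- constructor 3; have [r1 [e_r1 lastr1 szr1 mem_r1]] := walk_rev j_sym e_r.
  by rewrite lastr in e_r1 lastr1 mem_r1; exists r1, z; rewrite szr1 mem_q1 mem_r1.
Qed.

(* Each vertex z of a crowded parade spans an interval [lo z, hi z] of parade positions: the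
   parade vertex v i spans [i, i], and a spectator next to v i and v i.+1 spans [i, i.+1]. *)
Definition frame (T : finType) (e : rel T) (p : nat) (v : nat -> T) (lo hi : T -> nat) : Prop :=
  [/\ forall i, i < p -> lo (v i) = i /\ hi (v i) = i,
      forall z, [/\ lo z <= hi z, hi z <= (lo z).+1, hi z < p & lo z = hi z -> z = v (lo z)],
      forall z w, z != w -> hi w <= (lo z).+1 -> hi z <= (lo w).+1 -> e z w &
      forall z w, hi z = (lo z).+1 -> hi w = (lo w).+1 -> lo w = (lo z).+1 -> e z w].

Lemma frame_sub (T : finType) (e e' : rel T) p v lo hi :
  subrel e e' -> frame e p v lo hi -> frame e' p v lo hi.
Proof.
move=> sub_e [v_lohi lohi close out]; split=> // z w.
- by move=> neq h1 h2; apply: sub_e; apply: close.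
- by move=> h1 h2 h3; apply: sub_e; apply: out.
Qed.

Lemma frame_rev (T : finType) (e : rel T) p v lo hi :
  symmetric e -> frame e p v lo hi ->
  frame e p (fun i => v (p.-1 - i)) (fun z => p.-1 - hi z) (fun z => p.-1 - lo z).
Proof.
move=> e_sym [v_lohi lohi close out]; split=> [i lt_ip|z|z w neq h1 h2|z w h1 h2 h3].
- by have [|-> ->] := v_lohi (p.-1 - i); lia.
- have [h1 h2 h3 h4] := lohi z; split; try lia.
  by move=> eq_lohi; rewrite subKn; last lia; have eq_z : lo z = hi z by [lia]; rewrite -eq_z -h4.
- have [a1 a2 a3 _] := lohi z; have [b1 b2 b3 _] := lohi w.
  by apply: close => //; lia.
- have [a1 a2 a3 _] := lohi z; have [b1 b2 b3 _] := lohi w.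
  by rewrite e_sym; apply: out; lia.
Qed.

Lemma frame_bounds (T : finType) (e : rel T) p v lo hi z : frame e p v lo hi ->
  [/\ lo z <= hi z, hi z <= (lo z).+1 & hi z < p].
Proof. by case=> _ /(_ z)[]. Qed.

Lemma frame_spectator (T : finType) (e : rel T) p v lo hi z : frame e p v lo hi ->
  z != v (lo z) -> hi z = (lo z).+1.
Proof.
case=> _ /(_ z)[z1 z2 _ z4] _ _ neq_z; suff : lo z <> hi z by move: z1 z2; clear; lia.
by move=> /z4 def_z; rewrite -def_z eqxx in neq_z.
Qed.

Section Frames.
Variables (T : finType) (e : rel T) (p : nat) (v : nat -> T) (lo hi : T -> nat).
Hypothesis frame_e : frame e p v lo hi.

(** The vertex [x] may be a spectator, so for [m = 0] the walk need not end at [v (lo x)]; hence the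
    condition on the endpoint. *)
Lemma parade_walk x a m : a = (lo x).+1 -> a + m <= p ->
  path e x [seq v i | i <- iota a m] /\
  (0 < m -> last x [seq v i | i <- iota a m] = v (lo x + m)).
Proof.
have [v_lohi lohi close _] := frame_e.
elim: m x a => // m IHm x a def_a lt_p /=.
have [lo_va hi_va] := v_lohi a ltac:(lia).
have [|e_m last_m] := IHm (v a) a.+1 _ ltac:(lia); first by rewrite lo_va.
have [_ hi_x _ _] := lohi x.
rewrite e_m andbT; split; last first.
  case: m {IHm e_m} lt_p last_m => [|m] lt_p last_m _; first by rewrite addn1 def_a.
  by transitivity (v (lo (v a) + m.+1)); [apply: last_m | rewrite lo_va def_a addSnnS].
apply: close; rewrite ?lo_va ?hi_va; try lia.
by apply/eqP => eq_x; move: lo_va; rewrite -eq_x; lia.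
Qed.

(** The walk runs from [x] through the parade vertices strictly between [lo x] and [hi y] to [y].
    The [maxn 1] covers a spectator [x] and the parade vertex [y] at the lower end of its span, one
    step apart. *)
Lemma frame_walk x y : lo x <= lo y ->
  exists q, [/\ path e x q, last x q = y, size q <= maxn 1 (hi y - lo x) &
    forall j, lo x < j -> j < hi y -> v j \in x :: q].
Proof.
move=> le_xy; have [v_lohi lohi close _] := frame_e.
have [x1 x2 x3 x4] := lohi x; have [y1 y2 y3 y4] := lohi y.
have [near|far] := leqP (hi y) (lo x).+1.
  have [eq_xy|neq_xy] := eqVneq x y; first by exists [::]; split=> // j; lia.
  exists [:: y]; split=> //=; [|lia|by move=> j; lia].
  by rewrite andbT; apply: close => //; lia.
pose m := (hi y - lo x).-1.
have [e_m last_m] := @parade_walk x _ m erefl ltac:(rewrite /m; lia).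
exists (rcons [seq v i | i <- iota (lo x).+1 m] y); split.
- rewrite rcons_path e_m last_m /=; last by rewrite /m; lia.
  have [lo_v hi_v] := v_lohi (lo x + m) ltac:(rewrite /m; lia).
  apply: close; rewrite ?lo_v ?hi_v; rewrite /m; try lia.
  by apply/eqP => eq_y; move: hi_v; rewrite eq_y /m; lia.
- by rewrite last_rcons.
- by rewrite size_rcons size_map size_iota /m; lia.
- move=> j lt_xj lt_jy; rewrite inE mem_rcons inE map_f ?orbT // mem_iota /m; lia.
Qed.

(** For [s = v 0] the bound [hi s] is 0 and leaves no step for reaching [s] from another vertex;
    hence the second hypothesis. *)
Lemma walk_from_left x s : lo x = 0 -> (s = v 0 -> x = s) ->
  exists q, [/\ path e x q, last x q = s, size q <= hi s & all (fun z => lo z <= lo s) (x :: q)].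
Proof.
move=> lo_x s_x; have [v_lohi lohi close _] := frame_e.
have [x1 x2 x3 x4] := lohi x; have [s1 s2 s3 s4] := lohi s.
have [lo_s|lo_s] := posnP (lo s).
  have [eq_xs|neq_xs] := eqVneq x s; first by exists [::]; rewrite /= lo_x.
  have hi_s : hi s = 1.
    suff : hi s <> lo s by lia.
    by move=> eq_s; move: neq_xs; rewrite s_x ?eqxx // (s4 (esym eq_s)) lo_s.
  exists [:: s]; split=> //=; rewrite ?lo_x ?lo_s ?hi_s //.
  by rewrite andbT; apply: close; lia.
have [e_m last_m] := @parade_walk x _ (lo s) erefl ltac:(lia).
have {last_m} := last_m lo_s; rewrite lo_x add0n => last_m; rewrite lo_x in e_m.
have all_m : all (fun z => lo z <= lo s) [seq v i | i <- iota 1 (lo s)].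
  apply/allP => z /mapP[i]; rewrite mem_iota => /andP[i1 i2] ->.
  by have [->] := v_lohi i ltac:(lia).
have [eq_s|neq_s] := eqVneq (lo s) (hi s).
  exists [seq v i | i <- iota 1 (lo s)]; split=> //; first by rewrite last_m -s4.
    by rewrite size_map size_iota.
  by rewrite /= lo_x all_m.
exists (rcons [seq v i | i <- iota 1 (lo s)] s); split.
- rewrite rcons_path e_m last_m /=; have [lo_v hi_v] := v_lohi (lo s) ltac:(lia).
  apply: close; rewrite ?lo_v ?hi_v; try lia.
  by apply/eqP => eq_v; rewrite -eq_v lo_v hi_v eqxx in neq_s.
- by rewrite last_rcons.
- by rewrite size_rcons size_map size_iota; lia.
- by rewrite /= all_rcons all_m lo_x leqnn.
Qed.

End Frames.

(** * Detours through an edge between distant spans *)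

Section LongEdges.
Variables (T : finType) (e : rel T) (p : nat) (v : nat -> T) (lo hi : T -> nat).
Hypotheses (e_sym : symmetric e) (frame_e : frame e p v lo hi).

(** Mirror image of [walk_from_left]: the frame is reflected and the resulting walk reversed. *)
Lemma walk_to_right t y : hi y = p.-1 -> (t = v p.-1 -> y = t) ->
  exists q, [/\ path e t q, last t q = y, size q <= p.-1 - lo t & all (fun z => hi t <= hi z) (t :: q)].
Proof.
move=> hi_y t_y; have [v_lohi lohi _ _] := frame_e.
have := walk_from_left (frame_rev e_sym frame_e); move=> /(_ y t).
rewrite hi_y subnn subn0 => /(_ erefl t_y)[q [e_q lastq szq all_q]].
have [q' [e_q' lastq' szq' mem_q']] := walk_rev e_sym e_q.
rewrite lastq in e_q' lastq' mem_q'; exists q'; rewrite szq'; split=> //.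
rewrite (eq_all_r mem_q'); apply: sub_all all_q => z.
by have [_ _ z3 _] := lohi z; have [_ _ t3 _] := lohi t; lia.
Qed.

(** The edge jumps over [v (lo s).+1], whose [lo] is too large for the part before the jump and
    whose [hi] is too small for the part after it. *)
Lemma long_edge_walk x y s t q1 q2 :
  e s t -> (lo s).+2 <= hi t ->
  path e x q1 -> last x q1 = s -> all (fun z => lo z <= lo s) (x :: q1) ->
  path e t q2 -> last t q2 = y -> all (fun z => hi t <= hi z) (t :: q2) ->
  (size q1 + size q2).+1 < p ->
  exists q, [/\ path e x q, last x q = y, size q < p & v (lo s).+1 \notin x :: q].
Proof.
have [v_lohi lohi _ _] := frame_e.
move=> est long e_q1 last1 all1 e_q2 last2 all2 sz.
exists (q1 ++ t :: q2); split.
- by rewrite cat_path e_q1 last1 /= est.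
- by rewrite last_cat.
- by rewrite size_cat addnS.
have [_ _ t3 _] := lohi t.
have [lo_v hi_v] := v_lohi (lo s).+1 ltac:(lia).
rewrite -cat_cons mem_cat negb_or; apply/andP; split; apply/negP.
- by move=> /(allP all1); rewrite lo_v ltnn.
- by move=> /(allP all2); rewrite hi_v; lia.
Qed.

(** In general [hi s] steps lead to [s] and [p.-1 - lo t] lead on from [t], so [gap] gives a total
    below [p]. An end costs an extra step when [s = v 0] differs from [x], or [t = v p.-1] differs
    from [y]; in tight cases the step is saved by an [out] edge from the spectator [x] or [y]. *)
Lemma long_edge_detour x y s t : lo x = 0 -> hi y = p.-1 ->
  e s t -> (lo s).+2 <= hi t -> hi s < lo t ->
  exists q, [/\ path e x q, last x q = y, size q < p & v (lo s).+1 \notin x :: q].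
Proof.
move=> lo_x hi_y est long gap; have [v_lohi _ close out] := frame_e.
have [x1 x2 x3] := frame_bounds x frame_e; have [y1 y2 y3] := frame_bounds y frame_e.
have [s1 s2 s3] := frame_bounds s frame_e; have [t1 t2 t3] := frame_bounds t frame_e.
have [left_exc|left_ok] := boolP ((s == v 0) && (x != s)).
- have /andP[/eqP def_s neq_xs] := left_exc.
  have [lo_s hi_s] : lo s = 0 /\ hi s = 0 by rewrite def_s; apply: v_lohi; lia.
  have hi_x : hi x = 1.
    by rewrite (frame_spectator frame_e) lo_x // -def_s.
  have exs : e x s by apply: close; lia.
  have [right_exc|right_ok] := boolP ((t == v p.-1) && (y != t)).
  + have /andP[/eqP def_t neq_yt] := right_exc.
    have [lo_t hi_t] : lo t = p.-1 /\ hi t = p.-1 by rewrite def_t; apply: v_lohi; lia.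
    have lo_y : hi y = (lo y).+1.
      apply: (frame_spectator frame_e); apply: contraNneq neq_yt => def_y.
      have [lo_y|lo_y] := eqVneq (lo y) p.-1; first by rewrite def_y lo_y def_t.
      by have [_] := v_lohi (lo y) ltac:(lia); rewrite -def_y; lia.
    have ety : e t y by apply: close; rewrite 1?eq_sym //; lia.
    (* The walk [x], [s], [t], [y] has four vertices. For [p = 3] the ends [x] and [y] have spans
       [0, 1] and [1, 2] and are adjacent. *)
    have [p3|p4] := leqP p 3; last first.
      apply: (@long_edge_walk x y s t [:: s] [:: y]) => //=.
      * by rewrite exs.
      * by rewrite lo_x lo_s.
      * by rewrite ety.
      * by rewrite hi_y hi_t leqnn.
    rewrite lo_s -lo_x; apply: (@long_edge_walk x y x y [::] [::]); rewrite /= ?leqnn //.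
    * by apply: out; lia.
    * by lia.
    * by lia.
  + have [|q2 [e2 last2 sz2 all2]] := @walk_to_right t y hi_y.
      by move=> def_t; move: right_ok; rewrite def_t eqxx /= negbK => /eqP.
    (* Otherwise [t] has span [1, 2] and is adjacent to [x], so [s] is bypassed. *)
    have [lo_t|lo_t] := leqP 2 (lo t).
      apply: (@long_edge_walk x y s t [:: s] q2) => //=.
      * by rewrite exs.
      * by rewrite lo_x lo_s.
      * by clear - sz2 lo_t t1 t3; lia.
    rewrite lo_s -lo_x; apply: (@long_edge_walk x y x t [::] q2) => //.
    * by apply: out; lia.
    * by lia.
    * by rewrite /= leqnn.
    * by clear - sz2 t1 t3 gap long; rewrite add0n; lia.
- have [|q1 [e1 last1 sz1 all1]] := walk_from_left frame_e (s := s) lo_x.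
    by move=> def_s; move: left_ok; rewrite def_s eqxx /= negbK => /eqP.
  have [right_exc|right_ok] := boolP ((t == v p.-1) && (y != t)).
  + have /andP[/eqP def_t neq_yt] := right_exc.
    have [lo_t hi_t] : lo t = p.-1 /\ hi t = p.-1 by rewrite def_t; apply: v_lohi; lia.
    have lo_y : hi y = (lo y).+1.
      apply: (frame_spectator frame_e); apply: contraNneq neq_yt => def_y.
      have [lo_y|lo_y] := eqVneq (lo y) p.-1; first by rewrite def_y lo_y def_t.
      by have [_] := v_lohi (lo y) ltac:(lia); rewrite -def_y; lia.
    have ety : e t y by apply: close; rewrite 1?eq_sym //; lia.
    (* Otherwise [s] is a spectator whose span ends where that of [y] begins, so [t] is bypassed. *)
    have [hi_s|hi_s] := ltnP (hi s).+2 p.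
      apply: (@long_edge_walk x y s t q1 [:: y]) => //=.
      * by rewrite ety.
      * by rewrite hi_y hi_t leqnn.
      * by clear - sz1 hi_s; lia.
    apply: (@long_edge_walk x y s y q1 [::]) => //.
    * by apply: out; lia.
    * by lia.
    * by rewrite /= leqnn.
    * by clear - sz1 gap lo_t t3; rewrite addn0; lia.
  + have [|q2 [e2 last2 sz2 all2]] := @walk_to_right t y hi_y.
      by move=> def_t; move: right_ok; rewrite def_t eqxx /= negbK => /eqP.
    apply: (@long_edge_walk x y s t q1 q2) => //.
    by clear - sz1 sz2 gap t1 t3; lia.
Qed.

End LongEdges.

(** * Frames from crowded parades, and the effect of extra edges *)

Lemma zip_mem (S1 S2 : eqType) (s : seq S1) (t : seq S2) a b :
  (a, b) \in zip s t -> a \in s /\ b \in t.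
Proof.
elim: s t => [|c s IHs] [|d t] //=; rewrite [_ \in _ :: zip _ _]in_cons => /orP[/eqP[-> ->]|/IHs[sa tb]].
  by rewrite !mem_head.
by rewrite !in_cons sa tb !orbT.
Qed.

Lemma edge_in_path_mem (G : mgraph) vs es (x y : V G) j :
  edge_in_path vs es x y j -> x \in vs /\ y \in vs.
Proof.
by case/orP=> /zip_mem[/zip_mem[vx /mem_behead vy] _].
Qed.

Lemma crowded_frame (G : mgraph) p u v vs es : @crowded_with G p u v vs es ->
  exists lo hi, frame (@adj G) p (nth u vs) lo hi /\
    forall x y, x \in vs -> y \in vs -> mul x y <= 1.
Proof.
move=> [[/usp_path_geodesic[t [def_vs geo_t sim_t]] _] szvs spectator common].
have uniq_vs : uniq vs by rewrite def_vs; apply: unique_geodesic_uniq geo_t.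
have adj_step i : i.+1 < p -> adj (nth u vs i) (nth u vs i.+1).
  by rewrite -szvs def_vs => lt_i; have [e_t _] := geo_t; apply: (pathP u e_t).
have span z : exists lh : nat * nat, [/\ lh.1 <= lh.2 <= lh.1.+1, lh.2 < p,
    z \in vs -> lh = (index z vs, index z vs) &
    z \notin vs -> [/\ lh.2 = lh.1.+1, adj z (nth u vs lh.1) & adj z (nth u vs lh.2)]].
  have [zvs|nzvs] := boolP (z \in vs).
    by exists (index z vs, index z vs); rewrite /= leqnn leqnSn -szvs index_mem.
  have [a [b [avs bvs neq_ab [eza ezb eab] _]]] := spectator z nzvs.
  have lt_a : index a vs < p by rewrite -szvs index_mem.
  have lt_b : index b vs < p by rewrite -szvs index_mem.
  (* The two parade neighbours of a spectator are adjacent, and the parade is chordless, so they are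
     consecutive. *)
  have : index b vs = (index a vs).+1 \/ index a vs = (index b vs).+1.
    rewrite def_vs in avs bvs *.
    exact: unique_geodesic_index geo_t (@adj_irr G) (@adj_sym G) avs bvs eab.
  move=> [eq_ba|eq_ab].
    exists (index a vs, index b vs); rewrite /= !nth_index // eza ezb.
    by split=> //; rewrite eq_ba leqnn leqnSn.
  exists (index b vs, index a vs); rewrite /= !nth_index // eza ezb.
  by split=> //; rewrite eq_ab leqnn leqnSn.
have [lh lhP] := fin_all_exists span.
exists (fun z => (lh z).1), (fun z => (lh z).2); split; last first.
  by move=> x y; rewrite def_vs => xvs yvs; apply: (simple_walk_mul geo_t sim_t).
have lh_out z : (lh z).2 = (lh z).1.+1 -> z \notin vs.
  by move=> eq_z; apply/negP => zvs; have [_ _ /(_ zvs) def_lh _] := lhP z; move: eq_z; rewrite def_lh /=; lia.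
have nth_out z : z \notin vs -> forall i, i = (lh z).1 \/ i = (lh z).2 -> adj z (nth u vs i).
  by move=> nzvs i; have [_ _ _ /(_ nzvs)[_ e1 e2]] := lhP z; case=> ->.
split=> [i lt_ip|z|z w neq_zw|z w z_out w_out eq_zw].
- have ivs : nth u vs i \in vs by rewrite mem_nth // szvs.
  by have [_ _ /(_ ivs)-> _] := lhP (nth u vs i); rewrite /= index_uniq // szvs.
- have [/andP[h1 h2] h3 h4 h5] := lhP z; split=> // eq_lh.
  have [zvs|nzvs] := boolP (z \in vs); first by rewrite h4 //= nth_index.
  by have [eq_z _ _] := h5 nzvs; move: eq_lh; rewrite eq_z; lia.
- have [zvs|nzvs] := boolP (z \in vs); have [wvs|nwvs] := boolP (w \in vs).
  + have [_ lt_z /(_ zvs) def_z _] := lhP z; have [_ lt_w /(_ wvs) def_w _] := lhP w.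
    rewrite def_z /= in lt_z *; rewrite def_w /= in lt_w * => le_wz le_zw.
    have neq_idx : index z vs <> index w vs.
      by move=> eq_idx; move: neq_zw; rewrite -(nth_index u zvs) eq_idx nth_index // eqxx.
    have [eq_w|eq_z] : index w vs = (index z vs).+1 \/ index z vs = (index w vs).+1.
      move: neq_idx le_wz le_zw; clear; move: (index z vs) (index w vs) => i j; lia.
    * rewrite -(nth_index u zvs) -(nth_index u wvs) eq_w; apply: adj_step.
      by rewrite -eq_w.
    * rewrite adj_sym -(nth_index u zvs) -(nth_index u wvs) eq_z; apply: adj_step.
      by rewrite -eq_z.
  + have [_ _ /(_ zvs) def_z _] := lhP z; have [_ _ _ /(_ nwvs)[eq_w _ _]] := lhP w.
    rewrite def_z /= => h1 h2; rewrite adj_sym -(nth_index u zvs); apply: nth_out nwvs _ _.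
    by move: eq_w h1 h2; clear; lia.
  + have [_ _ /(_ wvs) def_w _] := lhP w; have [_ _ _ /(_ nzvs)[eq_z _ _]] := lhP z.
    rewrite def_w /= => h1 h2; rewrite -(nth_index u wvs); apply: nth_out nzvs _ _.
    by move: eq_z h1 h2; clear; lia.
  (* Two spectators with close spans have equal spans, hence a common parade neighbour. *)
  + have [_ lt_z _ /(_ nzvs)[eq_z ez _]] := lhP z; have [_ _ _ /(_ nwvs)[eq_w ew _]] := lhP w.
    move=> h1 h2; apply: common => //; exists (nth u vs (lh z).1); split=> //.
      by rewrite mem_nth // szvs; apply: leq_trans lt_z; rewrite eq_z ltnS.
    by apply: nth_out => //; left; move: eq_z eq_w h1 h2; clear; lia.
- have nzvs := lh_out z z_out; have nwvs := lh_out w w_out.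
  have [_ lt_z _ _] := lhP z.
  apply: common => //; first by apply/eqP => eq_z; move: eq_zw; rewrite eq_z; clear; lia.
  exists (nth u vs (lh z).2); split; first by rewrite mem_nth // szvs.
    by apply: nth_out => //; right.
  by apply: nth_out => //; left; rewrite z_out eq_zw.
Qed.

(* An increased multiplicity is either a doubled parade edge or a new edge joining vertices
   whose spans are far apart; the former doubles an edge of the canonical walk from x to y,
   the latter provides a detour. *)
Lemma augmented_escapes (G : mgraph) p m vs lo hi (mu : V G -> V G -> nat) s t :
  1 < p -> frame (@adj G) p vs lo hi ->
  (forall x y, adj x y -> lo x != hi x -> mul x y = m) ->
  (forall x y, mu x y = mu y x) -> (forall x, mu x x = 0) ->
  (forall x y, mul x y <= mu x y <= m) -> mul s t < mu s t ->
  forall x y, escapes mu p x y.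
Proof.
move=> p_gt1 frame_G mul_out mu_sym mu_irr mu_bounds lt_st x y.
have j_sym : symmetric (joined mu) by move=> z w; rewrite /joined mu_sym.
have sub_j : subrel (@adj G) (joined mu).
  by move=> z w ezw; have /andP[le_zw _] := mu_bounds z w; exact: leq_trans ezw le_zw.
wlog le_xy : x y / lo x <= lo y.
  move=> wlog_xy; have [/wlog_xy //|/ltnW/wlog_xy] := leqP (lo x) (lo y).
  exact: escapes_sym.
have [<-|neq_xy] := eqVneq x y; first by exists [::]; split=> //; [exact: ltnW | constructor 1].
have [q [e_q lastq szq v_q]] := frame_walk frame_G le_xy.
have [x1 x2 x3] := frame_bounds x frame_G; have [y1 y2 y3] := frame_bounds y frame_G.
have szq_p : size q < p by move: szq x3 y3 p_gt1; clear; lia.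
have j_q := sub_path sub_j e_q.
have [short|long_q] := ltnP (size q).+1 p; first by exists q; split=> //; constructor 1.
have neq_st : s != t by apply: contraTneq lt_st => ->; rewrite mul_irr mu_irr.
have [est|nst] := boolP (adj s t).
- have m_gt1 : 1 < m.
    by have /andP[_ le_m] := mu_bounds s t; move: est lt_st le_m; rewrite /adj; clear; lia.
  have span_eq z w : adj z w -> mul z w < m -> lo z = hi z.
    by move=> ezw lt_m; apply/eqP; apply: contraTT lt_m => /(mul_out z w ezw)->; rewrite ltnn.
  have lt_st_m : mul s t < m by have /andP[_ le_m] := mu_bounds s t; exact: leq_trans lt_st le_m.
  have span_s := span_eq s t est lt_st_m.
  have span_t : lo t = hi t by apply: (span_eq t s); rewrite ?(mul_sym t s) // adj_sym.
  have mu_out z w : adj z w -> lo z != hi z -> 1 < mu z w.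
    by move=> ezw /(mul_out z w ezw) eq_m; have /andP[+ _] := mu_bounds z w; rewrite eq_m; exact: leq_trans.
  have neq_adj z w : adj z w -> z != w by move=> ezw; apply: contraTneq ezw => ->; rewrite adj_irr.
  exists q; split=> //; constructor 2.
  (* If an end of [q] is a spectator, its edge on [q] has [m] copies. Otherwise [q] is so long that
     it runs through the whole parade, including [s] and [t]. *)
  have [span_x|nspan_x] := eqVneq (lo x) (hi x); last first.
    case: q e_q {lastq szq v_q j_q} szq_p long_q => [|w q] /= ; first by move: p_gt1; clear; lia.
    move=> /andP[exw _] _ _; exists x, w; rewrite !inE !eqxx orbT; split=> //; first exact: neq_adj.
    exact: mu_out.
  have [span_y|nspan_y] := eqVneq (lo y) (hi y); last first.
    case/lastP: q e_q lastq {szq v_q j_q} szq_p long_q => [|q w] /=; first by move: p_gt1; clear; lia.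
    rewrite rcons_path last_rcons => /andP[_ ewy] def_w; rewrite def_w in ewy * => _ _.
    exists (last x q), y; rewrite -rcons_cons !mem_rcons mem_head inE mem_last orbT.
    by split=> //; [exact: neq_adj | rewrite mu_sym; apply: mu_out; rewrite // adj_sym].
  have [v_span lohi _ _] := frame_G.
  have lt_xy : lo x < lo y.
    rewrite ltn_neqAle le_xy andbT; apply: contraNneq neq_xy => eq_lo.
    have [_ _ _ /(_ span_x) ->] := lohi x; have [_ _ _ /(_ span_y) ->] := lohi y.
    by rewrite eq_lo.
  have parade z : lo z = hi z -> z \in x :: q.
    move=> span_z; have [_ _ z3 /(_ span_z) def_z] := lohi z.
    have [_ _ _ /(_ span_x) def_x] := lohi x; have [_ _ _ /(_ span_y) def_y] := lohi y.
    have [lo_z|lo_z] := posnP (lo z).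
      have -> : z = x by rewrite def_z def_x; congr (vs _); move: szq long_q p_gt1 y3 span_x span_y lo_z lt_xy; clear; lia.
      exact: mem_head.
    have [hi_z|hi_z] := eqVneq (lo z) (lo y); last first.
      rewrite def_z; apply: v_q; move: szq long_q p_gt1 x3 y3 z3 span_x span_y span_z lo_z hi_z lt_xy; clear; lia.
    have -> : z = y by rewrite def_z def_y hi_z.
    by rewrite -lastq mem_last.
  exists s, t; rewrite !parade //; split=> //.
  by move: est lt_st; rewrite /adj; clear; lia.
- have [v_span lohi close out] := frame_G.
  have detour s' t' : ~~ adj s' t' -> (lo s').+2 <= hi t' -> joined mu s' t' -> escapes mu p x y.
    move=> ns't' far js't'.
    have [s1 s2 s3] := frame_bounds s' frame_G; have [t1 t2 t3] := frame_bounds t' frame_G.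
    (* Were the spans to meet, [s'] and [t'] would be consecutive spectators, adjacent by [out]. *)
    have gap : hi s' < lo t'.
      have : ~ (hi s' = (lo s').+1 /\ hi t' = (lo t').+1 /\ lo t' = (lo s').+1).
        by move=> [h1 [h2 h3]]; move: ns't'; rewrite out.
      by move: s1 s2 t1 t2 far; clear; lia.
    have [lo_x hi_y] : lo x = 0 /\ hi y = p.-1 by move: szq long_q y3 far t3; clear; lia.
    have [q' [e_q' lastq' szq' nv_q']] :=
      long_edge_detour j_sym (frame_sub sub_j frame_G) lo_x hi_y js't' far gap.
    exists q; split=> //; constructor 3; exists q', (vs (lo s').+1); split=> //.
    by apply: v_q; rewrite ?lo_x ?hi_y //; move: far t3; clear; lia.
  have jst : joined mu s t by apply: leq_ltn_trans lt_st.
  have [far|near] := leqP (lo s).+2 (hi t); first exact: (detour s t).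
  apply: (detour t s); rewrite 1?adj_sym 1?j_sym //.
  have : ~ (hi t <= (lo s).+1 /\ hi s <= (lo t).+1).
    by move=> [h1 h2]; move: nst; rewrite close.
  by move: near; clear; lia.
Qed.

(** * Maximality of saturated crowded parades *)

Lemma maximal_of_escapes (G : mgraph) (n m k p : nat) :
  0 < p -> nv G = p + k -> nv G = n -> (forall x y : V G, mul x y <= m) -> is_usp G p ->
  (forall H s, minor G H -> is_sp H s -> k <= s) ->
  (forall mu : V G -> V G -> nat, (forall x y, mu x y = mu y x) -> (forall x, mu x x = 0) ->
     (forall x y, mul x y <= mu x y <= m) -> forall s t, mul s t < mu s t ->
     forall x y, escapes mu p x y) ->
  minor_maximal n m k G.
Proof.
move=> p_gt0 card_G nv_G mul_G usp_G floor_G esc; split.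
  split=> //; split=> //; exists G; split; first exact: rt_refl.
  by exists p; rewrite card_G addKn.
move=> H [nv_H mul_H [[H' [minHH' sp_H']] _]] minGH.
have [lab0 mod0] := model_self G; have [lab mod_lab] := model_minor minGH mod0.
have [|f [bij_f le_f]] := model_spanning mod_lab; first by rewrite card_ord nv_G nv_H.
exists f; split=> // x y; apply/eqP; rewrite eqn_leq.
have bounds z w : mul z w <= mul (f z) (f w) <= m.
  rewrite mul_H andbT; have [->|/le_f //] := eqVneq z w; by rewrite mul_irr.
have /andP[-> _] := bounds x y; rewrite andbT leqNgt; apply/negP => lt_xy.
(* The multiplicities of [H], carried to the vertices of [G], are modelled in [H'], which attains
   the floor [k] of [H]; an extra edge would make its spectator number exceed [k]. *)
have [lab1 mod1] := @model_bij _ (fun z w => mul (f z) (f w)) H f bij_f (fun _ _ => leqnn _).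
have [lab2 mod2] := model_minor minHH' mod1.
have escs : forall z w, escapes (fun z w => mul (f z) (f w)) p z w.
  apply: (esc _ _ _ bounds x y lt_xy) => [z w|z]; [exact: mul_sym | exact: mul_irr].
have := spectators_gt mod2 sp_H' p_gt0 escs.
by rewrite card_ord card_G addnC ltnn.
Qed.

Lemma floor_ge (G H : mgraph) k p s : nv G = p + k ->
  (forall x y, exists q, [/\ path (@adj G) x q, last x q = y & size q < p]) ->
  minor G H -> is_sp H s -> k <= s.
Proof.
move=> card_G walks minGH sp_H.
have [lab0 mod0] := model_self G.
have [lab mod_lab] := model_minor minGH mod0.
have := spectators_ge mod_lab sp_H walks; rewrite card_ord card_G addnC.
by rewrite leq_add2r.
Qed.

Lemma complete_maximal (G : mgraph) n m k : 1 < m -> nv G = n -> nv G = 1 + k ->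
  (forall x y : V G, x != y -> mul x y = m) -> minor_maximal n m k G.
Proof.
move=> m_gt1 nv_G card_G mul_G.
have le_m (x y : V G) : mul x y <= m.
  by have [->|/mul_G->] := eqVneq x y; rewrite ?mul_irr.
have floor_G H s : minor G H -> is_sp H s -> k <= s.
  move=> minGH sp_H.
  have [lab0 mod0] := model_self G.
  have [lab mod_lab] := model_minor minGH mod0.
  (* The strict criterion is used at 2, one above the parade number: the walk [x], [y] has two
     vertices, and its parallel edges regain the lost unit. *)
  have : #|V G| < s + 2.
    apply: (spectators_gt mod_lab sp_H) => // x y.
    have [<-|neq_xy] := eqVneq x y; first by exists [::]; split=> //; constructor 1.
    exists [:: y]; rewrite /= /joined mul_G //; split=> //; first by rewrite andbT ltnW.
    by constructor 2; exists x, y; rewrite !inE !eqxx orbT mul_G.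
  by rewrite card_ord card_G; clear; lia.
have G_gt0 := nv_pos G.
apply: (@maximal_of_escapes G n m k 1) => //.
  have single : usp_path (Ordinal G_gt0) (Ordinal G_gt0) [:: Ordinal G_gt0] [::].
    split=> // vs' es' [hd lst uniq' szes _].
    case: vs' hd lst uniq' szes => //= a [|b vs'] [->] /=; first by case: es'.
    by move=> lst /andP[]; rewrite -{1}lst mem_last.
  split; first by exists (Ordinal G_gt0), (Ordinal G_gt0), [:: Ordinal G_gt0], [::].
  move=> u v vs es /usp_path_geodesic[[|w t] [-> [e_t _] sim_t]] //.
  have := sim_t 0 isT; rewrite /= mul_G; first by move: m_gt1; clear; lia.
  by apply: contraTneq e_t => /= ->; rewrite adj_irr.
move=> mu mu_sym mu_irr bounds s t lt_st.
have /andP[_ le_st] := bounds s t; move: lt_st le_st.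
by have [->|/mul_G->] := eqVneq s t; [rewrite mu_irr | move: m_gt1; clear; lia].
Qed.

Lemma crowded_maximal (G : mgraph) n m k p : 1 < p -> 0 < m -> nv G = n -> nv G = p + k ->
  sat_crowded m p G -> minor_maximal n m k G.
Proof.
case: p => [|[|p]] // p_gt1 m_gt0 nv_G card_G [u [v [vs [es [crowded sat]]]]].
have [lo [hi [frame_G simple_G]]] := crowded_frame crowded.
have [[_ usp_G] szvs _ _] := crowded; rewrite szvs in usp_G.
(* Copy 0 of an edge with an end off the parade is not a parade edge, so saturation applies to
   it. *)
have mul_out x y : adj x y -> (x \in vs) && (y \in vs) = false -> mul x y = m.
  move=> exy nvs; apply: (sat x y 0 exy); apply/negP => /edge_in_path_mem[xvs yvs].
  by rewrite xvs yvs in nvs.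
have le_m (x y : V G) : mul x y <= m.
  have [exy|] := boolP (adj x y); last by rewrite /adj -leqNgt leqn0 => /eqP->.
  case vs_xy: ((x \in vs) && (y \in vs)); last by rewrite mul_out.
  have /andP[xvs yvs] := vs_xy; exact: leq_trans (simple_G x y xvs yvs) m_gt0.
have span_vs z : lo z != hi z -> z \notin vs.
  apply: contra => zvs; have [v_span _ _ _] := frame_G.
  have lt_z : index z vs < p.+2 by rewrite -szvs index_mem.
  by have [] := v_span _ lt_z; rewrite nth_index // => -> ->.
apply: (@maximal_of_escapes G n m k p.+2) => // [H s|mu mu_sym mu_irr bounds s t lt_st].
  apply: floor_ge card_G _ => x y.
  have walk a b : lo a <= lo b ->
      exists q, [/\ path (@adj G) a q, last a q = b & size q < p.+2].
    move=> /(frame_walk frame_G)[q [e_q lastq szq _]]; exists q; split=> //.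
    by apply: leq_ltn_trans szq _; have [_ _] := frame_bounds b frame_G; clear; lia.
  have [/walk //|/ltnW/walk[q [e_q lastq szq]]] := leqP (lo x) (lo y).
  have [q' [e_q' lastq' szq' _]] := walk_rev (@adj_sym G) e_q.
  by exists q'; rewrite -lastq szq'; split=> //; rewrite -lastq'.
apply: (augmented_escapes p_gt1 frame_G _ mu_sym mu_irr bounds lt_st) => x y exy /span_vs nxvs.
by apply: mul_out; rewrite // (negPf nxvs).
Qed.

Theorem theorem7p7 (n k m : nat) (G : mgraph) :
  ((k + 2 <= n /\ 1 <= m) \/ (k + 1 = n /\ 2 <= m)) ->
  nv G = n -> sat_crowded m (n - k) G ->
  minor_maximal n m k G.
Proof.
move=> [[le_kn m_gt0]|[def_n m_gt1]] nv_G.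
  by apply: crowded_maximal; rewrite // ?nv_G; lia.
(* Here [n - k] is 1, and [sat_crowded] reduces to its clause for complete multigraphs. *)
rewrite -def_n addKn /= => mul_G; apply: complete_maximal; rewrite ?nv_G //.
by rewrite -def_n addnC.
Qed.
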